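(* If a category $\mathcal{C}$ is algebraically coherent, then for every object $X$ of $\mathcal{C}$ the category $\mathsf{Pt}_X(\mathcal{C})$ of points over $X$ is also algebraically coherent.
   Context: A cospan $(f\colon X\to Z,\ g\colon Y\to Z)$ in a category with finite limits is jointly strongly epimorphic if every monomorphism into $Z$ through which both $f$ and $g$ factor is an isomorphism. A functor between categories with finite limits is coherent if it preserves finite limits and jointly strongly epimorphic pairs. $\mathsf{Pt}_X(\mathcal{C})$ is the category of points over $X$: objects are triples $(A,\ p\colon A\to X,\ s\colon X\to A)$ with $ps=1_X$, and morphisms are morphisms between the objects $A$ commuting with the $p$'s and the $s$'s. For $f\colon X\to Y$, the change-of-base functor $f^*\colon \mathsf{Pt}_Y(\mathcal{C})\to\mathsf{Pt}_X(\mathcal{C})$ is pulling back along $f$. A category $\mathcal{C}$ with finite limits is algebraically coherent if $f^*$ is coherent for every morphism $f$ of $\mathcal{C}$. *)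

(* Defs.v *)
From Stdlib Require Import List FinFun ProofIrrelevance IndefiniteDescription.

Set Implicit Arguments.
Unset Strict Implicit.
Unset Printing Implicit Defensive.

Declare Scope cat_scope.
Delimit Scope cat_scope with cat.
Local Open Scope cat_scope.

(** * Categories and functors *)

Record category : Type := Category {
  Ob :> Type;
  Hom : Ob -> Ob -> Type;
  id : forall X, Hom X X;
  comp : forall X Y Z, Hom Y Z -> Hom X Y -> Hom X Z;
  comp_id_l : forall X Y (f : Hom X Y), comp (id Y) f = f;
  comp_id_r : forall X Y (f : Hom X Y), comp f (id X) = f;
  comp_assoc : forall W X Y Z (h : Hom Y Z) (g : Hom X Y) (f : Hom W X),
    comp h (comp g f) = comp (comp h g) f
}.

Arguments Hom {c} X Y.
Arguments id {c} X.
Arguments comp {c X Y Z} g f : rename.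

Notation "g ∘ f" := (comp g f) (at level 40, left associativity) : cat_scope.

Record functor (C D : category) : Type := Functor {
  fob :> C -> D;
  fmap : forall X Y : C, Hom X Y -> Hom (fob X) (fob Y);
  fmap_id : forall X : C, fmap (id X) = id (fob X);
  fmap_comp : forall (X Y Z : C) (g : Hom Y Z) (f : Hom X Y),
    fmap (g ∘ f) = fmap g ∘ fmap f
}.

Arguments fmap {C D} F {X Y} f : rename.

Lemma functor_comp_id (C D E : category) (G : functor D E) (F : functor C D)
  (X : C) : fmap G (fmap F (id X)) = id (G (F X)).
Proof. now rewrite !fmap_id. Qed.

Lemma functor_comp_comp (C D E : category) (G : functor D E) (F : functor C D)
  (X Y Z : C) (g : Hom Y Z) (f : Hom X Y) :
  fmap G (fmap F (g ∘ f)) = fmap G (fmap F g) ∘ fmap G (fmap F f).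
Proof. now rewrite !fmap_comp. Qed.

Definition functor_comp (C D E : category) (G : functor D E) (F : functor C D) :
  functor C E :=
  {| fob := fun X => G (F X);
     fmap := fun X Y (f : Hom X Y) => fmap G (fmap F f);
     fmap_id := functor_comp_id G F;
     fmap_comp := functor_comp_comp G F |}.

Definition is_mono (C : category) (X Y : C) (m : Hom X Y) : Prop :=
  forall (W : C) (a b : Hom W X), m ∘ a = m ∘ b -> a = b.

Definition is_iso (C : category) (X Y : C) (f : Hom X Y) : Prop :=
  exists g : Hom Y X, g ∘ f = id X /\ f ∘ g = id Y.

(** * Finite limits *)

Record cone (J C : category) (D : functor J C) : Type := Cone {
  apex : C;
  leg : forall j : J, Hom apex (D j);
  leg_natural : forall (i j : J) (u : Hom i j), fmap D u ∘ leg i = leg j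
}.

Arguments leg {J C D} c j : rename.

Definition is_limit (J C : category) (D : functor J C) (c : cone D) : Prop :=
  forall c' : cone D,
    exists! u : Hom (apex c') (apex c), forall j : J, leg c j ∘ u = leg c' j.

Definition finite_category (J : category) : Prop :=
  Finite J /\ forall i j : J, Finite (Hom i j).

Definition has_finite_limits (C : category) : Prop :=
  forall (J : category) (D : functor J C), finite_category J ->
    exists c : cone D, is_limit c.

Lemma map_cone_natural (J C E : category) (D : functor J C) (F : functor C E)
  (c : cone D) (i j : J) (u : Hom i j) :
  fmap (functor_comp F D) u ∘ fmap F (leg c i) = fmap F (leg c j).
Proof. simpl. now rewrite <- fmap_comp, leg_natural. Qed.

Definition map_cone (J C E : category) (D : functor J C) (F : functor C E)
  (c : cone D) : cone (functor_comp F D) :=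
  {| apex := F (apex c) : E;
     leg := fun j => fmap F (leg c j) : Hom _ (functor_comp F D j);
     leg_natural := map_cone_natural F c |}.

Definition preserves_finite_limits (C E : category) (F : functor C E) : Prop :=
  forall (J : category) (D : functor J C), finite_category J ->
    forall c : cone D, is_limit c -> is_limit (map_cone F c).

(** * Coherent functors *)

Definition jointly_strongly_epic (C : category) (X Y Z : C)
  (f : Hom X Z) (g : Hom Y Z) : Prop :=
  forall (M : C) (m : Hom M Z), is_mono m ->
    (exists f' : Hom X M, f = m ∘ f') ->
    (exists g' : Hom Y M, g = m ∘ g') ->
    is_iso m.

Definition preserves_jointly_strongly_epic (C E : category) (F : functor C E) :
  Prop :=
  forall (X Y Z : C) (f : Hom X Z) (g : Hom Y Z),
    jointly_strongly_epic f g -> jointly_strongly_epic (fmap F f) (fmap F g).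

(** Used only for categories with finite limits; [Pt C X] below has finite limits
    as soon as [C] does. *)
Definition coherent (C E : category) (F : functor C E) : Prop :=
  preserves_finite_limits F /\ preserves_jointly_strongly_epic F.

(** * Pullbacks *)

Record pullback (C : category) (X Y Z : C) (f : Hom X Z) (g : Hom Y Z) : Type :=
  Pullback {
    pb_ob : C;
    pb_fst : Hom pb_ob X;
    pb_snd : Hom pb_ob Y;
    pb_comm : f ∘ pb_fst = g ∘ pb_snd;
    pb_univ : forall (W : C) (a : Hom W X) (b : Hom W Y), f ∘ a = g ∘ b ->
      exists! u : Hom W pb_ob, pb_fst ∘ u = a /\ pb_snd ∘ u = b
  }.

Definition pb_lift (C : category) (X Y Z : C) (f : Hom X Z) (g : Hom Y Z)
  (P : pullback f g) (W : C) (a : Hom W X) (b : Hom W Y)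
  (e : f ∘ a = g ∘ b) : Hom W (pb_ob P) :=
  proj1_sig (constructive_definite_description _ (pb_univ P e)).

Lemma pb_lift_fst (C : category) (X Y Z : C) (f : Hom X Z) (g : Hom Y Z)
  (P : pullback f g) (W : C) (a : Hom W X) (b : Hom W Y) (e : f ∘ a = g ∘ b) :
  pb_fst P ∘ pb_lift P e = a.
Proof.
exact (proj1 (proj2_sig (constructive_definite_description _ (pb_univ P e)))).
Qed.

Lemma pb_lift_snd (C : category) (X Y Z : C) (f : Hom X Z) (g : Hom Y Z)
  (P : pullback f g) (W : C) (a : Hom W X) (b : Hom W Y) (e : f ∘ a = g ∘ b) :
  pb_snd P ∘ pb_lift P e = b.
Proof.
exact (proj2 (proj2_sig (constructive_definite_description _ (pb_univ P e)))).
Qed.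

Lemma pb_hom_ext (C : category) (X Y Z : C) (f : Hom X Z) (g : Hom Y Z)
  (P : pullback f g) (W : C) (u v : Hom W (pb_ob P)) :
  pb_fst P ∘ u = pb_fst P ∘ v -> pb_snd P ∘ u = pb_snd P ∘ v -> u = v.
Proof.
intros e1 e2.
assert (e : f ∘ (pb_fst P ∘ v) = g ∘ (pb_snd P ∘ v))
  by now rewrite !comp_assoc, pb_comm.
destruct (pb_univ P e) as [w [_ Hw]].
now rewrite <- (Hw u (conj e1 e2)), <- (Hw v (conj eq_refl eq_refl)).
Qed.

Inductive cospan_ob : Set := cospan_l | cospan_r | cospan_z.

Definition cospan_hom (i j : cospan_ob) : Set :=
  match i, j with
  | cospan_l, cospan_l | cospan_r, cospan_r | _, cospan_z => unit
  | _, _ => Empty_set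
  end.

Definition cospan_id (i : cospan_ob) : cospan_hom i i :=
  match i with cospan_l | cospan_r | cospan_z => tt end.

Definition cospan_comp (i j k : cospan_ob) :
  cospan_hom j k -> cospan_hom i j -> cospan_hom i k.
Proof. destruct i, j, k; simpl; intros u v; first [exact tt | tauto]. Defined.

Lemma cospan_hom_irr (i j : cospan_ob) (u v : cospan_hom i j) : u = v.
Proof. now destruct i, j, u, v. Qed.

Definition cospan_cat : category :=
  {| Ob := cospan_ob;
     Hom := cospan_hom;
     id := cospan_id;
     comp := cospan_comp;
     comp_id_l := fun i j u => cospan_hom_irr _ u;
     comp_id_r := fun i j u => cospan_hom_irr _ u;
     comp_assoc := fun h i j k u v w => cospan_hom_irr _ _ |}.

Lemma cospan_cat_finite : finite_category cospan_cat.
Proof.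
split.
- exists (cospan_l :: cospan_r :: cospan_z :: nil).
  intros []; simpl; tauto.
- intros [] []; simpl;
    first [ exists (tt :: nil); intros []; simpl; tauto
          | exists nil; intros [] ].
Qed.

Section CospanDiagram.

Variables (C : category) (X Y Z : C) (f : Hom X Z) (g : Hom Y Z).

Definition cospan_fob (i : cospan_cat) : C :=
  match i with cospan_l => X | cospan_r => Y | cospan_z => Z end.

Definition cospan_fmap (i j : cospan_cat) :
  Hom i j -> Hom (cospan_fob i) (cospan_fob j) :=
  match i, j with
  | cospan_l, cospan_l => fun _ => id X
  | cospan_r, cospan_r => fun _ => id Y
  | cospan_z, cospan_z => fun _ => id Z
  | cospan_l, cospan_z => fun _ => f
  | cospan_r, cospan_z => fun _ => g
  | cospan_l, cospan_r | cospan_r, cospan_l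
  | cospan_z, cospan_l | cospan_z, cospan_r =>
      fun u : Empty_set => match u with end
  end.

Lemma cospan_fmap_id (i : cospan_cat) : cospan_fmap (id i) = id (cospan_fob i).
Proof. now destruct i. Qed.

Lemma cospan_fmap_comp (i j k : cospan_cat) (v : Hom j k) (u : Hom i j) :
  cospan_fmap (v ∘ u) = cospan_fmap v ∘ cospan_fmap u.
Proof.
destruct i, j, k; simpl in *;
  first [ now destruct u | now destruct v | now rewrite comp_id_l
        | now rewrite comp_id_r ].
Qed.

Definition cospan_diagram : functor cospan_cat C :=
  {| fob := cospan_fob;
     fmap := cospan_fmap;
     fmap_id := cospan_fmap_id;
     fmap_comp := cospan_fmap_comp |}.

Definition cospan_leg (W : C) (a : Hom W X) (b : Hom W Y) (i : cospan_cat) :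
  Hom W (cospan_diagram i) :=
  match i with cospan_l => a | cospan_r => b | cospan_z => f ∘ a end.

Lemma cospan_leg_natural (W : C) (a : Hom W X) (b : Hom W Y)
  (e : f ∘ a = g ∘ b) (i j : cospan_cat) (u : Hom i j) :
  fmap cospan_diagram u ∘ cospan_leg a b i = cospan_leg a b j.
Proof.
destruct i, j; simpl in *;
  first [ now destruct u | now rewrite comp_id_l | now auto ].
Qed.

Definition cospan_cone (W : C) (a : Hom W X) (b : Hom W Y)
  (e : f ∘ a = g ∘ b) : cone cospan_diagram :=
  {| apex := W; leg := cospan_leg a b; leg_natural := cospan_leg_natural e |}.

Lemma pullback_exists (L : has_finite_limits C) :
  exists P : pullback f g, True.
Proof.
destruct (L _ cospan_diagram cospan_cat_finite) as [c Hc].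
pose proof (@leg_natural _ _ _ c cospan_l cospan_z tt) as Hl.
pose proof (@leg_natural _ _ _ c cospan_r cospan_z tt) as Hr.
simpl in Hl, Hr.
unshelve eexists; [unshelve eapply Pullback | exact I].
- exact (apex c).
- exact (leg c cospan_l).
- exact (leg c cospan_r).
- now rewrite Hl, Hr.
- intros W a b e.
  destruct (Hc (cospan_cone e)) as [u [Hu Hu']]; simpl in u, Hu, Hu'.
  exists u; split.
  + exact (conj (Hu cospan_l) (Hu cospan_r)).
  + intros v [H1 H2]; apply Hu'; intros []; simpl; trivial.
    now rewrite <- Hl, <- H1, comp_assoc.
Qed.

Definition chosen_pullback (L : has_finite_limits C) : pullback f g :=
  proj1_sig (constructive_indefinite_description _ (pullback_exists L)).

End CospanDiagram.

(** * The category of points over an object *)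

Record point (C : category) (X : C) : Type := Point {
  pt_ob : C;
  pt_p : Hom pt_ob X;
  pt_s : Hom X pt_ob;
  pt_ps : pt_p ∘ pt_s = id X
}.

Record point_hom (C : category) (X : C) (A B : point X) : Type := PointHom {
  pt_mor : Hom (pt_ob A) (pt_ob B);
  pt_mor_p : pt_p B ∘ pt_mor = pt_p A;
  pt_mor_s : pt_mor ∘ pt_s A = pt_s B
}.

Lemma point_hom_ext (C : category) (X : C) (A B : point X)
  (h k : point_hom A B) : pt_mor h = pt_mor k -> h = k.
Proof.
destruct h as [h hp hs], k as [k kp ks]; simpl; intros <-.
f_equal; apply proof_irrelevance.
Qed.

Definition point_id (C : category) (X : C) (A : point X) : point_hom A A :=
  {| pt_mor := id (pt_ob A);
     pt_mor_p := comp_id_r (pt_p A);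
     pt_mor_s := comp_id_l (pt_s A) |}.

Lemma point_comp_p (C : category) (X : C) (A B D : point X)
  (k : point_hom B D) (h : point_hom A B) :
  pt_p D ∘ (pt_mor k ∘ pt_mor h) = pt_p A.
Proof. now rewrite comp_assoc, !pt_mor_p. Qed.

Lemma point_comp_s (C : category) (X : C) (A B D : point X)
  (k : point_hom B D) (h : point_hom A B) :
  (pt_mor k ∘ pt_mor h) ∘ pt_s A = pt_s D.
Proof. now rewrite <- comp_assoc, !pt_mor_s. Qed.

Definition point_comp (C : category) (X : C) (A B D : point X)
  (k : point_hom B D) (h : point_hom A B) : point_hom A D :=
  {| pt_mor := pt_mor k ∘ pt_mor h;
     pt_mor_p := point_comp_p k h;
     pt_mor_s := point_comp_s k h |}.

Lemma point_comp_id_l (C : category) (X : C) (A B : point X)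
  (h : point_hom A B) : point_comp (point_id B) h = h.
Proof. apply point_hom_ext, comp_id_l. Qed.

Lemma point_comp_id_r (C : category) (X : C) (A B : point X)
  (h : point_hom A B) : point_comp h (point_id A) = h.
Proof. apply point_hom_ext, comp_id_r. Qed.

Lemma point_comp_assoc (C : category) (X : C) (A B D E : point X)
  (l : point_hom D E) (k : point_hom B D) (h : point_hom A B) :
  point_comp l (point_comp k h) = point_comp (point_comp l k) h.
Proof. apply point_hom_ext, comp_assoc. Qed.

Definition Pt (C : category) (X : C) : category :=
  {| Ob := point X;
     Hom := @point_hom C X;
     id := @point_id C X;
     comp := @point_comp C X;
     comp_id_l := @point_comp_id_l C X;
     comp_id_r := @point_comp_id_r C X;
     comp_assoc := @point_comp_assoc C X |}.

Arguments Pt : clear implicits.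

(** * Change of base *)

Section ChangeOfBase.

Variables (C : category) (X Y : C) (f : Hom X Y).
Variable P : forall A : point Y, pullback f (pt_p A).

Lemma cob_section_comm (A : point Y) :
  f ∘ id X = pt_p A ∘ (pt_s A ∘ f).
Proof. now rewrite comp_id_r, comp_assoc, pt_ps, comp_id_l. Qed.

Definition cob_ob (A : point Y) : point X :=
  {| pt_ob := pb_ob (P A);
     pt_p := pb_fst (P A);
     pt_s := pb_lift (P A) (cob_section_comm A);
     pt_ps := pb_lift_fst (P A) (cob_section_comm A) |}.

Lemma cob_mor_comm (A B : point Y) (h : point_hom A B) :
  f ∘ pb_fst (P A) = pt_p B ∘ (pt_mor h ∘ pb_snd (P A)).
Proof. now rewrite comp_assoc, pt_mor_p, pb_comm. Qed.

Definition cob_mor (A B : point Y) (h : point_hom A B) :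
  Hom (pb_ob (P A)) (pb_ob (P B)) := pb_lift (P B) (cob_mor_comm h).

Lemma cob_mor_s (A B : point Y) (h : point_hom A B) :
  cob_mor h ∘ pt_s (cob_ob A) = pt_s (cob_ob B).
Proof.
unfold cob_mor; simpl; apply pb_hom_ext; rewrite comp_assoc.
- now rewrite !pb_lift_fst.
- now rewrite !pb_lift_snd, <- comp_assoc, pb_lift_snd, comp_assoc, pt_mor_s.
Qed.

Definition cob_hom (A B : point Y) (h : point_hom A B) :
  point_hom (cob_ob A) (cob_ob B) :=
  {| pt_mor := cob_mor h : Hom (pt_ob (cob_ob A)) (pt_ob (cob_ob B));
     pt_mor_p := pb_lift_fst (P B) (cob_mor_comm h);
     pt_mor_s := cob_mor_s h |}.

Lemma cob_hom_id (A : Pt C Y) : cob_hom (id A) = id (cob_ob A : Pt C X).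
Proof.
apply point_hom_ext; simpl; unfold cob_mor; apply pb_hom_ext.
- now rewrite pb_lift_fst, comp_id_r.
- rewrite pb_lift_snd; simpl; now rewrite comp_id_r, comp_id_l.
Qed.

Lemma cob_hom_comp (A B D : Pt C Y) (k : Hom B D) (h : Hom A B) :
  cob_hom (k ∘ h) = (cob_hom k : Hom (cob_ob B : Pt C X) (cob_ob D))
                    ∘ (cob_hom h : Hom (cob_ob A : Pt C X) (cob_ob B)).
Proof.
apply point_hom_ext; simpl; unfold cob_mor; apply pb_hom_ext;
  rewrite comp_assoc.
- now rewrite !pb_lift_fst.
- rewrite !pb_lift_snd, <- (comp_assoc (pt_mor k)), pb_lift_snd; simpl.
  now rewrite comp_assoc.
Qed.

Definition change_of_base_along : functor (Pt C Y) (Pt C X) :=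
  {| fob := cob_ob : Pt C Y -> Pt C X;
     fmap := @cob_hom : forall A B : Pt C Y,
       Hom A B -> Hom (cob_ob A : Pt C X) (cob_ob B);
     fmap_id := cob_hom_id;
     fmap_comp := cob_hom_comp |}.

End ChangeOfBase.

Definition change_of_base (C : category) (L : has_finite_limits C) (X Y : C)
  (f : Hom X Y) : functor (Pt C Y) (Pt C X) :=
  change_of_base_along (fun A : point Y => chosen_pullback f (pt_p A) L).

(** By proof irrelevance the functor [change_of_base L f] does not depend on the
    witness [L]. *)
Definition algebraically_coherent (C : category) : Prop :=
  exists L : has_finite_limits C,
    forall (X Y : C) (f : Hom X Y), coherent (change_of_base L f).

(* Main.v *)
From Stdlib Require Import List FinFun.
Require Import Defs.

(** Let [A] be a point over [X], with underlying object [a].  A point over [A]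
    inside the category of points over [X] is an object [B] with a split
    epimorphism onto [a]; the structure that makes [B] a point over [X] is then
    forced, since its projection and section must be composites of those of [A]
    with the given ones.  Hence the forgetful functor
    [underlying_point A : Pt (Pt C X) A -> Pt C a] is an equivalence of
    categories ([underlying_point_ff], [underlying_point_es]).

    Pullbacks of points over [X] are computed in [C] ([underlying_pullback]), so
    these equivalences carry change of base along a morphism [f] of points to
    change of base along the morphism of [C] underlying [f], up to natural
    isomorphism ([underlying_point_change_of_base]).  The latter functor is
    coherent by hypothesis.  Equivalences are coherent and reflect coherence
    ([equivalence_coherent], [equivalence_reflects_coherent]), and coherence is
    stable under composition and natural isomorphism, so the former functor is
    coherent too.

    Finite limits of points over [X] are limits in [C] of the diagram extended
    by [X] as a new terminal vertex ([pt_finite_limits]). *)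

Set Implicit Arguments.
Unset Strict Implicit.
Unset Printing Implicit Defensive.
Local Open Scope cat_scope.

(** * Isomorphisms and equivalences of categories *)

Lemma is_iso_comp (C : category) (X Y Z : C) (g : Hom Y Z) (f : Hom X Y) :
  is_iso g -> is_iso f -> is_iso (g ∘ f).
Proof.
intros [g' [Hg1 Hg2]] [f' [Hf1 Hf2]]; exists (f' ∘ g'); split.
- now rewrite comp_assoc, <- (comp_assoc f'), Hg1, comp_id_r.
- now rewrite comp_assoc, <- (comp_assoc g), Hf2, comp_id_r.
Qed.

Lemma is_iso_fmap (C D : category) (F : functor C D) (X Y : C) (f : Hom X Y) :
  is_iso f -> is_iso (fmap F f).
Proof.
intros [g [H1 H2]]; exists (fmap F g).
now rewrite <- !fmap_comp, H1, H2, !fmap_id.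
Qed.

Record natural_iso (C D : category) (F G : functor C D) : Type := NaturalIso {
  ni_to : forall X : C, Hom (F X) (G X);
  ni_from : forall X : C, Hom (G X) (F X);
  ni_from_to : forall X : C, ni_from X ∘ ni_to X = id (F X);
  ni_to_from : forall X : C, ni_to X ∘ ni_from X = id (G X);
  ni_natural : forall (X Y : C) (f : Hom X Y),
    fmap G f ∘ ni_to X = ni_to Y ∘ fmap F f
}.

Lemma ni_natural_from (C D : category) (F G : functor C D)
  (n : natural_iso F G) (X Y : C) (f : Hom X Y) :
  fmap F f ∘ ni_from n X = ni_from n Y ∘ fmap G f.
Proof.
rewrite <- (comp_id_r (fmap G f)), <- (ni_to_from n X), (comp_assoc (fmap G f)).
now rewrite ni_natural, !comp_assoc, ni_from_to, comp_id_l.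
Qed.

(** The inverse on morphisms is part of the data, so that a cone in the target
    can be pulled back leg by leg without a choice principle. *)
Record fully_faithful (C D : category) (F : functor C D) : Type :=
  FullyFaithful {
    preimage : forall X Y : C, Hom (F X) (F Y) -> Hom X Y;
    fmap_preimage : forall (X Y : C) (h : Hom (F X) (F Y)),
      fmap F (preimage h) = h;
    fmap_inj : forall (X Y : C) (f g : Hom X Y), fmap F f = fmap F g -> f = g
  }.

Definition essentially_surjective (C D : category) (F : functor C D) : Prop :=
  forall Y : D, exists (X : C) (u : Hom (F X) Y), is_iso u.

Lemma ff_reflects_iso (C D : category) (F : functor C D)
  (ff : fully_faithful F) (X Y : C) (f : Hom X Y) :
  is_iso (fmap F f) -> is_iso f.
Proof.
intros [g [H1 H2]]; exists (preimage ff g).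
now split; apply (fmap_inj ff); rewrite fmap_comp, fmap_preimage, fmap_id.
Qed.

Lemma es_preserves_mono (C D : category) (F : functor C D)
  (ff : fully_faithful F) (es : essentially_surjective F) (X Y : C)
  (m : Hom X Y) : is_mono m -> is_mono (fmap F m).
Proof.
intros Hm W a b e.
destruct (es W) as [W' [w [w' [_ Hw]]]].
assert (e' : preimage ff (a ∘ w) = preimage ff (b ∘ w)).
{ apply Hm, (fmap_inj ff).
  now rewrite !fmap_comp, !fmap_preimage, !comp_assoc, e. }
apply (f_equal (fmap F)) in e'; rewrite !fmap_preimage in e'.
now rewrite <- (comp_id_r a), <- (comp_id_r b), <- Hw, !comp_assoc, e'.
Qed.

(** * Coherence and equivalences *)

(** Unbundled form of the universal property.  The diagrams
    [functor_comp (functor_comp G F) D] and [functor_comp G (functor_comp F D)]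
    agree on objects and morphisms by conversion but are not convertible as
    records, so cones over them cannot be exchanged directly; families of legs
    can. *)
Lemma is_limit_legs (J C : category) (D : functor J C) (c : cone D) :
  is_limit c <->
  (forall (W : C) (l : forall j : J, Hom W (D j)),
     (forall (i j : J) (u : Hom i j), fmap D u ∘ l i = l j) ->
     exists! u : Hom W (apex c), forall j : J, leg c j ∘ u = l j).
Proof.
split.
- intros H W l Hl; exact (H {| apex := W; leg := l; leg_natural := Hl |}).
- intros H [W l Hl]; exact (H W l Hl).
Qed.

Lemma coherent_comp (C D E : category) (G : functor D E) (F : functor C D) :
  coherent F -> coherent G -> coherent (functor_comp G F).
Proof.
intros [HF1 HF2] [HG1 HG2]; split.
- intros J K HJ c Hc.
  pose proof (HG1 _ _ HJ _ (HF1 _ _ HJ _ Hc)) as H.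
  rewrite is_limit_legs in H |- *; exact H.
- intros X Y Z f g H; exact (HG2 _ _ _ _ _ (HF2 _ _ _ _ _ H)).
Qed.

Lemma coherent_natural_iso (C D : category) (F G : functor C D)
  (n : natural_iso F G) : coherent F -> coherent G.
Proof.
intros [HF1 HF2]; split.
- intros J K HJ c Hc.
  pose proof (HF1 _ _ HJ _ Hc) as H.
  rewrite is_limit_legs in H |- *; simpl in H |- *.
  intros W l Hl.
  destruct (H W (fun j => ni_from n (K j) ∘ l j)) as [u [Hu Hu']].
  { intros i j v; now rewrite comp_assoc, ni_natural_from, <- comp_assoc, Hl. }
  exists (ni_to n (apex c) ∘ u); split.
  + intros j; rewrite comp_assoc, ni_natural, <- comp_assoc, Hu.
    now rewrite comp_assoc, ni_to_from, comp_id_l.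
  + intros v Hv; rewrite (Hu' (ni_from n (apex c) ∘ v)).
    * now rewrite comp_assoc, ni_to_from, comp_id_l.
    * intros j; now rewrite comp_assoc, ni_natural_from, <- comp_assoc, Hv.
- intros X Y Z f g H M m Hm [f' Hf] [g' Hg].
  (* Transported along [n], [m] is a subobject of [F Z], through which [F f]
     and [F g] factor. *)
  assert (Hi : is_iso (ni_from n Z ∘ m)).
  { apply (HF2 _ _ _ _ _ H).
    - intros W a b e; apply Hm.
      rewrite <- (comp_id_l (m ∘ a)), <- (comp_id_l (m ∘ b)).
      now rewrite <- (ni_to_from n Z), <- !comp_assoc, !(comp_assoc _ m), e.
    - exists (f' ∘ ni_to n X).
      rewrite comp_assoc, <- (comp_assoc _ m), <- Hf, <- ni_natural_from.
      now rewrite <- comp_assoc, ni_from_to, comp_id_r.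
    - exists (g' ∘ ni_to n Y).
      rewrite comp_assoc, <- (comp_assoc _ m), <- Hg, <- ni_natural_from.
      now rewrite <- comp_assoc, ni_from_to, comp_id_r. }
  assert (Hn : is_iso (ni_to n Z)).
  { exists (ni_from n Z); exact (conj (ni_from_to n Z) (ni_to_from n Z)). }
  rewrite <- (comp_id_l m), <- (ni_to_from n Z), <- comp_assoc.
  now apply is_iso_comp.
Qed.

(** Every cone, and every subobject, in the target is isomorphic to one in the
    image, where the universal properties of the source apply. *)
Lemma equivalence_coherent (C D : category) (F : functor C D)
  (ff : fully_faithful F) (es : essentially_surjective F) : coherent F.
Proof.
split.
- intros J K HJ c Hc; rewrite is_limit_legs in Hc |- *; simpl.
  intros W l Hl.
  destruct (es W) as [W' [w [w' [Hw1 Hw2]]]].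
  destruct (Hc W' (fun j => preimage ff (l j ∘ w))) as [u [Hu Hu']].
  { intros i j v; apply (fmap_inj ff).
    rewrite fmap_comp, !fmap_preimage, comp_assoc; f_equal; apply Hl. }
  exists (fmap F u ∘ w'); split.
  + intros j; rewrite comp_assoc, <- fmap_comp, Hu, fmap_preimage.
    now rewrite <- comp_assoc, Hw2, comp_id_r.
  + intros v Hv; rewrite (Hu' (preimage ff (v ∘ w))).
    * now rewrite fmap_preimage, <- comp_assoc, Hw2, comp_id_r.
    * intros j; apply (fmap_inj ff).
      now rewrite fmap_comp, !fmap_preimage, comp_assoc, Hv.
- intros X Y Z f g H M m Hm [f' Hf] [g' Hg].
  destruct (es M) as [M' [w [w' [Hw1 Hw2]]]].
  assert (Hi : is_iso (preimage ff (m ∘ w))).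
  { apply H.
    - intros W a b e; apply (f_equal (fmap F)) in e.
      rewrite !fmap_comp, !fmap_preimage, <- !comp_assoc in e; apply Hm in e.
      apply (fmap_inj ff).
      rewrite <- (comp_id_l (fmap F a)), <- (comp_id_l (fmap F b)), <- Hw1.
      now rewrite <- !comp_assoc, e.
    - exists (preimage ff (w' ∘ f')); apply (fmap_inj ff).
      rewrite fmap_comp, !fmap_preimage, comp_assoc, <- (comp_assoc m), Hw2.
      now rewrite comp_id_r.
    - exists (preimage ff (w' ∘ g')); apply (fmap_inj ff).
      rewrite fmap_comp, !fmap_preimage, comp_assoc, <- (comp_assoc m), Hw2.
      now rewrite comp_id_r. }
  apply (is_iso_fmap F) in Hi; rewrite fmap_preimage in Hi.
  rewrite <- (comp_id_r m), <- Hw2, comp_assoc.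
  apply is_iso_comp; [exact Hi | now exists w].
Qed.

Lemma equivalence_reflects_coherent (C D E : category) (F : functor D E)
  (G : functor C D) (ff : fully_faithful F) (es : essentially_surjective F) :
  coherent (functor_comp F G) -> coherent G.
Proof.
intros [H1 H2]; split.
- intros J K HJ c Hc.
  pose proof (H1 _ _ HJ _ Hc) as H.
  rewrite is_limit_legs in H |- *; simpl in H |- *.
  intros W l Hl.
  destruct (H (F W) (fun j => fmap F (l j))) as [u [Hu Hu']].
  { intros i j v; now rewrite <- fmap_comp, Hl. }
  exists (preimage ff u); split.
  + intros j; apply (fmap_inj ff); now rewrite fmap_comp, fmap_preimage, Hu.
  + intros v Hv; apply (fmap_inj ff); rewrite fmap_preimage; apply Hu'.
    intros j; now rewrite <- fmap_comp, Hv.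
- intros X Y Z f g H M m Hm [f' Hf] [g' Hg].
  apply (ff_reflects_iso ff), (H2 _ _ _ _ _ H).
  + exact (es_preserves_mono ff es Hm).
  + exists (fmap F f'); simpl; now rewrite Hf, fmap_comp.
  + exists (fmap F g'); simpl; now rewrite Hg, fmap_comp.
Qed.

(** * Finite limits of points *)

Section AddTerminal.

Variable J : category.

Definition top_hom (i j : option J) : Type :=
  match i, j with
  | Some i, Some j => Hom i j
  | _, None => unit
  | None, Some _ => Empty_set
  end.

Definition top_id (i : option J) : top_hom i i :=
  match i with Some i => id i | None => tt end.

Definition top_comp (i j k : option J) :
  top_hom j k -> top_hom i j -> top_hom i k :=
  match i, j, k with
  | Some i, Some j, Some k => fun v u => v ∘ u
  | _, _, None => fun _ _ => tt
  | None, Some _, Some _ => fun _ (u : Empty_set) => match u with end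
  | _, None, Some _ => fun (v : Empty_set) _ => match v with end
  end.

Lemma top_id_l (i j : option J) (u : top_hom i j) : top_comp (top_id j) u = u.
Proof. destruct i, j; try destruct u; trivial; apply comp_id_l. Qed.

Lemma top_id_r (i j : option J) (u : top_hom i j) : top_comp u (top_id i) = u.
Proof. destruct i, j; try destruct u; trivial; apply comp_id_r. Qed.

Lemma top_assoc (h i j k : option J) (w : top_hom j k) (v : top_hom i j)
  (u : top_hom h i) : top_comp w (top_comp v u) = top_comp (top_comp w v) u.
Proof.
destruct h, i, j, k; try destruct u; try destruct v; try destruct w; trivial;
  apply comp_assoc.
Qed.

Definition add_terminal : category :=
  {| Ob := option J;
     Hom := top_hom;
     id := top_id;
     comp := top_comp;
     comp_id_l := top_id_l;
     comp_id_r := top_id_r;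
     comp_assoc := top_assoc |}.

Lemma add_terminal_finite : finite_category J -> finite_category add_terminal.
Proof.
intros [[l Hl] H]; split.
- exists (None :: map (@Some J) l); intros [i |]; [right | now left].
  apply in_map, Hl.
- intros [i |] [j |]; simpl.
  + apply H.
  + exists (tt :: nil); intros []; now left.
  + exists nil; intros [].
  + exists (tt :: nil); intros []; now left.
Qed.

End AddTerminal.

Section LimitOfPoints.

Variables (C : category) (X : C) (J : category) (D : functor J (Pt C X)).

Definition over_fob (i : add_terminal J) : C :=
  match i with Some j => pt_ob (D j) | None => X end.

Definition over_fmap (i j : add_terminal J) :
  Hom i j -> Hom (over_fob i) (over_fob j) :=
  match i, j with
  | Some i, Some j => fun u : Hom i j => pt_mor (fmap D u)
  | Some i, None => fun _ => pt_p (D i)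
  | None, None => fun _ => id X
  | None, Some _ => fun u : Empty_set => match u with end
  end.

Lemma over_fmap_id (i : add_terminal J) : over_fmap (id i) = id (over_fob i).
Proof. destruct i; simpl; trivial; now rewrite fmap_id. Qed.

Lemma over_fmap_comp (i j k : add_terminal J) (v : Hom j k) (u : Hom i j) :
  over_fmap (v ∘ u) = over_fmap v ∘ over_fmap u.
Proof.
destruct i as [i |], j as [j |], k as [k |]; simpl in *;
  first [ now destruct u | now destruct v | now rewrite comp_id_l
        | now rewrite pt_mor_p | now rewrite fmap_comp ].
Qed.

Definition over_diagram : functor (add_terminal J) C :=
  {| fob := over_fob;
     fmap := over_fmap;
     fmap_id := over_fmap_id;
     fmap_comp := over_fmap_comp |}.

Definition over_leg (W : C) (l : forall j : J, Hom W (pt_ob (D j)))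
  (p : Hom W X) (i : add_terminal J) : Hom W (over_diagram i) :=
  match i with Some j => l j | None => p end.

Lemma over_leg_natural (W : C) (l : forall j : J, Hom W (pt_ob (D j)))
  (p : Hom W X) (Hl : forall (i j : J) (u : Hom i j),
    pt_mor (fmap D u) ∘ l i = l j)
  (Hp : forall j : J, pt_p (D j) ∘ l j = p)
  (i j : add_terminal J) (u : Hom i j) :
  fmap over_diagram u ∘ over_leg l p i = over_leg l p j.
Proof.
destruct i as [i |], j as [j |]; simpl in *;
  [apply Hl | apply Hp | destruct u | apply comp_id_l].
Qed.

(** The extra vertex makes the apex of a limit cone in [C] an object over [X];
    its section is the map induced by the sections of the vertices. *)
Lemma pt_limit_exists (c : cone over_diagram) :
  is_limit c -> exists d : cone D, is_limit d.
Proof.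
intros Hc; rewrite is_limit_legs in Hc.
pose (q := leg c None : Hom (apex c) X).
pose (r := fun j : J => leg c (Some j) : Hom (apex c) (pt_ob (D j))).
assert (Hrq : forall j, pt_p (D j) ∘ r j = q)
  by (intros j; exact (@leg_natural _ _ _ c (Some j) None tt)).
assert (Hr : forall i j (u : Hom i j), pt_mor (fmap D u) ∘ r i = r j)
  by (intros i j u; exact (@leg_natural _ _ _ c (Some i) (Some j) u)).
(* The uniqueness part of [s] later shows that mediating maps preserve
   sections. *)
destruct (Hc X (over_leg (fun j => pt_s (D j)) (id X))) as [s [Hs Hs']].
{ apply over_leg_natural.
  - intros i j u; apply pt_mor_s.
  - intros j; apply pt_ps. }
pose proof (Hs None : q ∘ s = id X) as Hqs.
pose proof (fun j => Hs (Some j) : r j ∘ s = pt_s (D j)) as Hrs.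
pose (L := {| pt_ob := apex c; pt_p := q; pt_s := s; pt_ps := Hqs |} : Pt C X).
pose (r' := fun j : J =>
  {| pt_mor := r j : Hom (pt_ob L) (pt_ob (D j));
     pt_mor_p := Hrq j; pt_mor_s := Hrs j |} : Hom L (D j)).
unshelve eexists {| apex := L; leg := r' |}.
{ intros i j u; apply point_hom_ext, Hr. }
rewrite is_limit_legs; simpl; intros W l Hl.
destruct (Hc (pt_ob W) (over_leg (fun j => pt_mor (l j)) (pt_p W)))
  as [u [Hu Hu']].
{ apply over_leg_natural.
  - intros i j v; exact (f_equal (@pt_mor _ _ _ _) (Hl i j v)).
  - intros j; apply pt_mor_p. }
assert (Hus : u ∘ pt_s W = s).
{ symmetry; apply Hs'; intros [j |]; rewrite comp_assoc, Hu; simpl.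
  - apply pt_mor_s.
  - apply pt_ps. }
exists {| pt_mor := u : Hom (pt_ob W) (pt_ob L);
          pt_mor_p := Hu None : pt_p L ∘ u = pt_p W; pt_mor_s := Hus |}.
split.
- intros j; apply point_hom_ext; exact (Hu (Some j)).
- intros v Hv; apply point_hom_ext; simpl; apply Hu'.
  intros [j |]; [exact (f_equal (@pt_mor _ _ _ _) (Hv j)) | exact (pt_mor_p v)].
Qed.

End LimitOfPoints.

Lemma pt_finite_limits (C : category) (L : has_finite_limits C) (X : C) :
  has_finite_limits (Pt C X).
Proof.
intros J D HJ.
destruct (L _ (over_diagram D) (add_terminal_finite HJ)) as [c Hc].
exact (pt_limit_exists Hc).
Qed.

(** * Pullbacks of points *)

Section UnderlyingPullback.

Variables (C : category) (L : has_finite_limits C) (X : C).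
Variables (A B D : Pt C X) (f : Hom A D) (g : Hom B D) (P : pullback f g).

Lemma underlying_pb_comm :
  pt_mor f ∘ pt_mor (pb_fst P) = pt_mor g ∘ pt_mor (pb_snd P).
Proof. exact (f_equal (@pt_mor _ _ _ _) (pb_comm P)). Qed.

(** The pullback [Q] in [C] of the underlying morphisms is itself a point over
    [X], so both universal properties apply: that of [P] gives [k] from [Q] to
    [P], that of [Q] gives [v] back.  The composite [k ∘ v] is the identity, so
    a map [w] into [P] is [k ∘ (v ∘ w)], and [v ∘ w] is determined by its two
    projections. *)
Lemma underlying_pb_univ (W : C) (a : Hom W (pt_ob A)) (b : Hom W (pt_ob B)) :
  pt_mor f ∘ a = pt_mor g ∘ b ->
  exists! u : Hom W (pt_ob (pb_ob P)),
    pt_mor (pb_fst P) ∘ u = a /\ pt_mor (pb_snd P) ∘ u = b.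
Proof.
intros e.
pose (Q := chosen_pullback (pt_mor f) (pt_mor g) L).
assert (es : pt_mor f ∘ pt_s A = pt_mor g ∘ pt_s B) by now rewrite !pt_mor_s.
assert (ps : (pt_p A ∘ pb_fst Q) ∘ pb_lift Q es = id X)
  by now rewrite <- comp_assoc, pb_lift_fst, pt_ps.
pose (Q' := {| pt_ob := pb_ob Q; pt_p := pt_p A ∘ pb_fst Q;
               pt_s := pb_lift Q es; pt_ps := ps |} : Pt C X).
assert (e2 : pt_p B ∘ pb_snd Q = pt_p A ∘ pb_fst Q).
{ now rewrite <- (pt_mor_p g), <- comp_assoc, <- pb_comm, comp_assoc, pt_mor_p. }
pose (q1 := {| pt_mor := pb_fst Q : Hom (pt_ob Q') (pt_ob A);
               pt_mor_p := eq_refl; pt_mor_s := pb_lift_fst Q es |} : Hom Q' A).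
pose (q2 := {| pt_mor := pb_snd Q : Hom (pt_ob Q') (pt_ob B);
               pt_mor_p := e2; pt_mor_s := pb_lift_snd Q es |} : Hom Q' B).
assert (e12 : f ∘ q1 = g ∘ q2) by apply point_hom_ext, pb_comm.
pose (k := pb_lift P e12).
assert (k1 : pt_mor (pb_fst P) ∘ pt_mor k = pb_fst Q)
  by exact (f_equal (@pt_mor _ _ _ _) (pb_lift_fst P e12)).
assert (k2 : pt_mor (pb_snd P) ∘ pt_mor k = pb_snd Q)
  by exact (f_equal (@pt_mor _ _ _ _) (pb_lift_snd P e12)).
pose (v := pb_lift Q underlying_pb_comm).
assert (vp : pt_p Q' ∘ v = pt_p (pb_ob P)).
{ simpl; unfold v; now rewrite <- comp_assoc, pb_lift_fst, pt_mor_p. }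
assert (vs : v ∘ pt_s (pb_ob P) = pt_s Q').
{ simpl; apply pb_hom_ext; rewrite comp_assoc; unfold v.
  - now rewrite !pb_lift_fst, pt_mor_s.
  - now rewrite !pb_lift_snd, pt_mor_s. }
pose (v' := {| pt_mor := v : Hom (pt_ob (pb_ob P)) (pt_ob Q');
               pt_mor_p := vp; pt_mor_s := vs |} : Hom (pb_ob P) Q').
assert (kv : pt_mor k ∘ v = id _).
{ assert (H : k ∘ v' = id (pb_ob P)).
  { apply pb_hom_ext; rewrite comp_assoc, comp_id_r; unfold k.
    - rewrite pb_lift_fst; apply point_hom_ext, pb_lift_fst.
    - rewrite pb_lift_snd; apply point_hom_ext, pb_lift_snd. }
  exact (f_equal (@pt_mor _ _ _ _) H). }
exists (pt_mor k ∘ pb_lift Q e); split.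
- split; rewrite comp_assoc.
  + rewrite k1; apply pb_lift_fst.
  + rewrite k2; apply pb_lift_snd.
- intros w [Hw1 Hw2].
  assert (Hv : v ∘ w = pb_lift Q e).
  { apply pb_hom_ext; rewrite comp_assoc; unfold v.
    - now rewrite !pb_lift_fst.
    - now rewrite !pb_lift_snd. }
  rewrite <- Hv; transitivity ((pt_mor k ∘ v) ∘ w); [apply comp_assoc |].
  now rewrite kv, comp_id_l.
Qed.

Definition underlying_pullback : pullback (pt_mor f) (pt_mor g) :=
  {| pb_ob := pt_ob (pb_ob P);
     pb_fst := pt_mor (pb_fst P);
     pb_snd := pt_mor (pb_snd P);
     pb_comm := underlying_pb_comm;
     pb_univ := underlying_pb_univ |}.

End UnderlyingPullback.

(** * Points over a point *)

Section PointsOverAPoint.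

Variables (C : category) (X : C) (A : Pt C X).

Definition underlying_point_ob (B : point A) : point (pt_ob A) :=
  {| pt_ob := pt_ob (pt_ob B);
     pt_p := pt_mor (pt_p B);
     pt_s := pt_mor (pt_s B);
     pt_ps := f_equal (@pt_mor _ _ _ _) (pt_ps B) |}.

Definition underlying_point_hom (B D : point A) (h : point_hom B D) :
  point_hom (underlying_point_ob B) (underlying_point_ob D) :=
  {| pt_mor := pt_mor (pt_mor h)
       : Hom (pt_ob (underlying_point_ob B)) (pt_ob (underlying_point_ob D));
     pt_mor_p := f_equal (@pt_mor _ _ _ _) (pt_mor_p h);
     pt_mor_s := f_equal (@pt_mor _ _ _ _) (pt_mor_s h) |}.

Definition underlying_point : functor (Pt (Pt C X) A) (Pt C (pt_ob A)).
Proof.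
refine {| fob := underlying_point_ob : Pt (Pt C X) A -> Pt C (pt_ob A);
          fmap := underlying_point_hom |}.
- intros B; now apply point_hom_ext.
- intros B D E k h; now apply point_hom_ext.
Defined.

(** A morphism compatible with the projections to and sections from [A] is
    compatible with those of [X], which factor through them. *)
Definition point_hom_over (B D : point A)
  (h : Hom (pt_ob (pt_ob B)) (pt_ob (pt_ob D)))
  (hp : pt_mor (pt_p D) ∘ h = pt_mor (pt_p B))
  (hs : h ∘ pt_mor (pt_s B) = pt_mor (pt_s D)) : point_hom B D.
Proof.
unshelve refine {| pt_mor := {| pt_mor := h |} : Hom (pt_ob B) (pt_ob D) |}.
- now rewrite <- (pt_mor_p (pt_p D)), <- comp_assoc, hp, pt_mor_p.
- now rewrite <- (pt_mor_s (pt_s B)), comp_assoc, hs, pt_mor_s.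
- apply point_hom_ext, hp.
- apply point_hom_ext, hs.
Defined.

Definition underlying_point_preimage (B D : Pt (Pt C X) A)
  (h : Hom (underlying_point B) (underlying_point D)) : Hom B D :=
  point_hom_over (pt_mor_p h) (pt_mor_s h).

Definition underlying_point_ff : fully_faithful underlying_point.
Proof.
refine {| preimage := underlying_point_preimage |}.
- intros B D h; now apply point_hom_ext.
- intros B D h k e; apply point_hom_ext, point_hom_ext.
  exact (f_equal (@pt_mor _ _ _ _) e).
Defined.

Lemma underlying_point_es : essentially_surjective underlying_point.
Proof.
intros B.
assert (ps : (pt_p A ∘ pt_p B) ∘ (pt_s B ∘ pt_s A) = id X).
{ rewrite comp_assoc, <- (comp_assoc (pt_p A)), pt_ps, comp_id_r; apply pt_ps. }
pose (B0 := {| pt_ob := pt_ob B; pt_p := pt_p A ∘ pt_p B;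
               pt_s := pt_s B ∘ pt_s A; pt_ps := ps |} : Pt C X).
assert (ep : pt_p B ∘ pt_s B0 = pt_s A)
  by (simpl; now rewrite comp_assoc, pt_ps, comp_id_l).
assert (es : pt_p B0 ∘ pt_s B = pt_p A)
  by (simpl; now rewrite <- comp_assoc, pt_ps, comp_id_r).
pose (q := {| pt_mor := pt_p B : Hom (pt_ob B0) (pt_ob A);
              pt_mor_p := eq_refl; pt_mor_s := ep |} : Hom B0 A).
pose (t := {| pt_mor := pt_s B : Hom (pt_ob A) (pt_ob B0);
              pt_mor_p := es; pt_mor_s := eq_refl |} : Hom A B0).
assert (qt : q ∘ t = id A)
  by (apply point_hom_ext; exact (pt_ps B)).
pose (B1 := {| pt_ob := B0; pt_p := q; pt_s := t; pt_ps := qt |}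
  : Pt (Pt C X) A).
exists B1.
exists {| pt_mor := id (pt_ob B) : Hom (pt_ob (underlying_point B1)) (pt_ob B);
          pt_mor_p := comp_id_r (pt_p B); pt_mor_s := comp_id_l (pt_s B) |}.
exists {| pt_mor := id (pt_ob B) : Hom (pt_ob B) (pt_ob (underlying_point B1));
          pt_mor_p := comp_id_r (pt_p B); pt_mor_s := comp_id_l (pt_s B) |}.
split; apply point_hom_ext, comp_id_l.
Qed.

End PointsOverAPoint.

(** * Change of base for points over a point *)

Definition pb_compare (C : category) (X Y Z : C) (f : Hom X Z) (g : Hom Y Z)
  (P Q : pullback f g) : Hom (pb_ob P) (pb_ob Q) := pb_lift Q (pb_comm P).

Lemma pb_compare_inv (C : category) (X Y Z : C) (f : Hom X Z) (g : Hom Y Z)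
  (P Q : pullback f g) : pb_compare Q P ∘ pb_compare P Q = id (pb_ob P).
Proof.
unfold pb_compare; apply pb_hom_ext; rewrite comp_assoc, comp_id_r.
- now rewrite !pb_lift_fst.
- now rewrite !pb_lift_snd.
Qed.

Lemma pb_compare_comp (C : category) (X Y Z : C) (f : Hom X Z) (g : Hom Y Z)
  (P Q : pullback f g) (W : C) (u : Hom W (pb_ob P)) (v : Hom W (pb_ob Q)) :
  pb_fst P ∘ u = pb_fst Q ∘ v -> pb_snd P ∘ u = pb_snd Q ∘ v ->
  pb_compare P Q ∘ u = v.
Proof.
intros e1 e2; unfold pb_compare; apply pb_hom_ext; rewrite comp_assoc.
- now rewrite pb_lift_fst.
- now rewrite pb_lift_snd.
Qed.

Lemma pb_compare_natural (C : category) (X Y Y' Z : C) (f : Hom X Z)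
  (g : Hom Y Z) (g' : Hom Y' Z) (P Q : pullback f g) (P' Q' : pullback f g')
  (h : Hom Y Y') (u : Hom (pb_ob P) (pb_ob P')) (v : Hom (pb_ob Q) (pb_ob Q')) :
  pb_fst P' ∘ u = pb_fst P -> pb_snd P' ∘ u = h ∘ pb_snd P ->
  pb_fst Q' ∘ v = pb_fst Q -> pb_snd Q' ∘ v = h ∘ pb_snd Q ->
  v ∘ pb_compare P Q = pb_compare P' Q' ∘ u.
Proof.
intros u1 u2 v1 v2; symmetry; apply pb_compare_comp; unfold pb_compare.
- now rewrite u1, comp_assoc, v1, pb_lift_fst.
- now rewrite u2, comp_assoc, v2, <- comp_assoc, pb_lift_snd.
Qed.

Section UnderlyingChangeOfBase.

Variables (C : category) (L : has_finite_limits C) (X : C) (A A' : Pt C X).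
Variable f : Hom A A'.
Variable P : forall B : point A', pullback f (pt_p B).
Variable Q : forall B : point (pt_ob A'), pullback (pt_mor f) (pt_p B).

Let F : functor (Pt (Pt C X) A') (Pt C (pt_ob A)) :=
  functor_comp (underlying_point A) (change_of_base_along P).

Let G : functor (Pt (Pt C X) A') (Pt C (pt_ob A)) :=
  functor_comp (change_of_base_along Q) (underlying_point A').

Let PB (B : Pt (Pt C X) A') :
  pullback (pt_mor f) (pt_p (underlying_point_ob B)) :=
  underlying_pullback L (P B).

Let QB (B : Pt (Pt C X) A') :
  pullback (pt_mor f) (pt_p (underlying_point_ob B)) :=
  Q (underlying_point_ob B).

Lemma underlying_cob_section_fst (B : Pt (Pt C X) A') :
  pb_fst (PB B) ∘ pt_s (F B) = pb_fst (QB B) ∘ pt_s (G B).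
Proof. exact (eq_trans (pt_ps (F B)) (eq_sym (pt_ps (G B)))). Qed.

Lemma underlying_cob_section_snd (B : Pt (Pt C X) A') :
  pb_snd (PB B) ∘ pt_s (F B) = pb_snd (QB B) ∘ pt_s (G B).
Proof.
transitivity (pt_s (underlying_point_ob B) ∘ pt_mor f).
- exact (f_equal (@pt_mor _ _ _ _) (pb_lift_snd (P B) (cob_section_comm f B))).
- symmetry; exact (pb_lift_snd (QB B) _).
Qed.

Definition underlying_cob_to (B : Pt (Pt C X) A') : Hom (F B) (G B) :=
  {| pt_mor := pb_compare (PB B) (QB B) : Hom (pt_ob (F B)) (pt_ob (G B));
     pt_mor_p := pb_lift_fst (QB B) (pb_comm (PB B));
     pt_mor_s := pb_compare_comp (underlying_cob_section_fst B)
                   (underlying_cob_section_snd B) |}.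

Definition underlying_cob_from (B : Pt (Pt C X) A') : Hom (G B) (F B) :=
  {| pt_mor := pb_compare (QB B) (PB B) : Hom (pt_ob (G B)) (pt_ob (F B));
     pt_mor_p := pb_lift_fst (PB B) (pb_comm (QB B));
     pt_mor_s := pb_compare_comp (eq_sym (underlying_cob_section_fst B))
                   (eq_sym (underlying_cob_section_snd B)) |}.

(** Both sides are pullbacks in [C] of the same pair of morphisms, with sections
    determined by the same two components. *)
Definition underlying_point_change_of_base : natural_iso G F.
Proof.
refine {| ni_to := underlying_cob_from; ni_from := underlying_cob_to |}.
- intros B; apply point_hom_ext; exact (pb_compare_inv (QB B) (PB B)).
- intros B; apply point_hom_ext; exact (pb_compare_inv (PB B) (QB B)).
- intros B D h; apply point_hom_ext.
  apply (pb_compare_natural (P := QB B) (Q := PB B) (P' := QB D) (Q' := PB D)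
           (h := pt_mor (underlying_point_hom h))
           (u := pt_mor (fmap G h)) (v := pt_mor (fmap F h))).
  + exact (pt_mor_p (fmap G h)).
  + exact (pb_lift_snd (QB D) _).
  + exact (pt_mor_p (fmap F h)).
  + exact (f_equal (@pt_mor _ _ _ _) (pb_lift_snd (P D) (cob_mor_comm P h))).
Defined.

End UnderlyingChangeOfBase.

Theorem corollary3p5 (C : category) (hC : algebraically_coherent C) (X : C) :
  algebraically_coherent (Pt C X).
Proof.
destruct hC as [L HL]; exists (@pt_finite_limits C L X); intros A A' f.
apply (equivalence_reflects_coherent (underlying_point_ff A)
         (@underlying_point_es _ _ A)).
apply (coherent_natural_iso (underlying_point_change_of_base L _
         (fun B : point (pt_ob A') => chosen_pullback (pt_mor f) (pt_p B) L))).
apply coherent_comp; [| apply HL].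
apply equivalence_coherent;
  [apply underlying_point_ff | apply underlying_point_es].
Qed.
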